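(* Let $\mathcal{C}$ be a class of groups with associated invariant length functions, and suppose that, for all $(K,\ell_K)\in\mathcal{C}$ and all finite nonempty sets $A$, the pair $(K\wr\mathrm{Sym}(A),\hat{\ell}_K^A)$ is in $\mathcal{C}$. Suppose that the group $G$ has a normal subgroup $N$ with the discrete $\mathcal{C}$-approximation property such that $G/N$ is amenable. Then $G$ has the discrete $\mathcal{C}$-approximation property.
   Context: An invariant length function on a group $K$ is a map $\ell:K\to[0,1]$ such that for all $x,y\in K$: $\ell(x)=0 \iff x=1$; $\ell(x^{-1})=\ell(x)$; $\ell(xy)\le \ell(x)+\ell(y)$; $\ell(xyx^{-1})=\ell(y)$. A class $\mathcal{C}$ of groups with associated invariant length functions is a collection of pairs $(K,\ell_K)$, where $K$ is a group and $\ell_K$ an invariant length function on $K$ (the same group may occur with several length functions). A weight function for a group $G$ is a map $\delta:G\to\mathbb{R}$, $g\mapsto\delta_g$, with $\delta_1=0$ and $\delta_g>0$ for all $1\neq g\in G$. Given a group $G$ with weight function $\delta$, a group $K$ with invariant length function $\ell_K$, $\epsilon>0$ and a finite subset $F\subseteq G$, a map $\phi:G\to K$ is an $(F,\epsilon,\delta,\ell_K)$-quasi-homomorphism if: $\phi(1)=1$; $\ell_K(\phi(gh)\phi(h)^{-1}\phi(g)^{-1})\le\epsilon$ for all $g,h\in F$; and $\ell_K(\phi(g))\ge\delta_g$ for all $g\in F\setminus\{1\}$. A group $G$ is $\mathcal{C}$-approximable if it has a weight function $\delta$ such that, for each $\epsilon>0$ and each finite subset $F$ of $G$, there exists an $(F,\epsilon,\delta,\ell_K)$-quasi-homomorphism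 $\phi:G\to K$ for some $(K,\ell_K)\in\mathcal{C}$. The group $G$ has the discrete $\mathcal{C}$-approximation property if it is $\mathcal{C}$-approximable with a weight function $\delta$ that can be chosen to be constant on all non-identity elements of $G$. For a group $K$ and a finite set $A$, the permutation wreath product $K\wr\mathrm{Sym}(A)$ is the semidirect product $\mathrm{Sym}(A)\ltimes B$, where $B$ is the group of all functions $b:A\to K$ under pointwise multiplication, and $\mathrm{Sym}(A)$ (acting on $A$ on the right, $a\mapsto a^\alpha$) acts on $B$ by $b^\alpha(a)=b(a^{\alpha^{-1}})$. Elements are pairs $(\alpha,b)$ with $\alpha\in\mathrm{Sym}(A)$, $b\in B$, multiplied by $(\alpha_1,b_1)(\alpha_2,b_2)=(\alpha_1\alpha_2,b_1^{\alpha_2}b_2)$. Given an invariant length function $\ell_K$ on $K$ and a finite nonempty set $A$, the invariant length function $\hat{\ell}_K^A$ on $K\wr\mathrm{Sym}(A)$ is defined by \[\hat{\ell}_K^A((\alpha,b))=\frac{1}{|A|}\left(\sum_{a\in A:\,a^\alpha=a}\ell_K(b(a))+\sum_{a\in A:\,a^\alpha\ne a}1\right).\] *)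

(* Defs.v *)
From HB Require Import structures.
From mathcomp Require Import all_boot all_order all_algebra all_fingroup.
From mathcomp Require Import all_classical all_reals.

Set Implicit Arguments.
Unset Strict Implicit.
Unset Printing Implicit Defensive.

Import Order.TTheory GRing.Theory Num.Theory.

Local Open Scope classical_set_scope.
Local Open Scope ring_scope.

Record invariant_length (R : realType) (K : groupType) (ell : K -> R) : Prop := {
  il_ge0 : forall x, 0 <= ell x ;
  il_le1 : forall x, ell x <= 1 ;
  il_eq0 : forall x, ell x = 0 <-> x = 1%g ;
  il_inv : forall x, ell x^-1%g = ell x ;
  il_mul : forall x y, ell (x * y)%g <= ell x + ell y ;
  il_conj : forall x y, ell (x * y * x^-1)%g = ell y }.

(* A predicate on pairs (K, ell_K), so that the same group may occur with
   several length functions. *)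
Definition length_class (R : realType) := forall K : groupType, (K -> R) -> Prop.

Definition is_length_class (R : realType) (C : length_class R) : Prop :=
  forall (K : groupType) (ell : K -> R), C K ell -> invariant_length ell.

Record weight_function (R : realType) (G : groupType) (delta : G -> R) : Prop := {
  wf_1 : delta 1%g = 0 ;
  wf_gt0 : forall g, g <> 1%g -> 0 < delta g }.

Record quasi_hom (R : realType) (G K : groupType) (F : set G) (eps : R)
    (delta : G -> R) (ell : K -> R) (phi : G -> K) : Prop := {
  qh_1 : phi 1%g = 1%g ;
  qh_mul : forall g h, F g -> F h ->
    ell (phi (g * h) * (phi h)^-1 * (phi g)^-1)%g <= eps ;
  qh_weight : forall g, F g -> g <> 1%g -> delta g <= ell (phi g) }.

Definition approximable_with (R : realType) (C : length_class R)
    (G : groupType) (delta : G -> R) : Prop :=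
  forall (eps : R) (F : set G), 0 < eps -> finite_set F ->
    exists (K : groupType) (ell : K -> R) (phi : G -> K),
      C K ell /\ quasi_hom F eps delta ell phi.

Definition approximable (R : realType) (C : length_class R)
    (G : groupType) : Prop :=
  exists delta : G -> R, weight_function delta /\ approximable_with C delta.

Definition discrete_approximation_property (R : realType) (C : length_class R)
    (G : groupType) : Prop :=
  exists delta : G -> R,
    [/\ weight_function delta, approximable_with C delta &
        exists c : R, forall g, g <> 1%g -> delta g = c].

Record wreath (K : groupType) (A : finType) : Type := Wreath {
  wreath_perm : {perm A} ;
  wreath_base : {ffun A -> K} }.

Section WreathGroup.
Context (K : groupType) (A : finType).
Implicit Types (s : {perm A}) (b : {ffun A -> K}) (x y : wreath K A).

Definition pair_of_wreath x := (wreath_perm x, wreath_base x).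
Definition wreath_of_pair (p : {perm A} * {ffun A -> K}) := Wreath p.1 p.2.

Lemma pair_of_wreathK : cancel pair_of_wreath wreath_of_pair.
Proof. by case. Qed.

HB.instance Definition _ := Choice.copy (wreath K A) (can_type pair_of_wreathK).

Local Open Scope group_scope.

(* In MathComp [(s * t) a = t (s a)]: {perm A} acts on A on the right. *)
Definition wreath_act b s : {ffun A -> K} := [ffun a => b (s^-1 a)].

Definition wreath_one : wreath K A := Wreath 1 1.
Definition wreath_mul x y : wreath K A :=
  Wreath (wreath_perm x * wreath_perm y)
         (wreath_act (wreath_base x) (wreath_perm y) * wreath_base y).
Definition wreath_inv x : wreath K A :=
  Wreath (wreath_perm x)^-1 (wreath_act (wreath_base x)^-1 (wreath_perm x)^-1).

Lemma wreath_mulA : associative wreath_mul.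
Proof.
move=> [s b] [t c] [u d]; rewrite /wreath_mul /=; congr Wreath; first exact: mulgA.
by apply/ffunP => a; rewrite !ffunE mulgA invMg permM.
Qed.

Lemma wreath_mul1 : left_id wreath_one wreath_mul.
Proof.
move=> [s b]; rewrite /wreath_mul /=; congr Wreath; first exact: mul1g.
by apply/ffunP => a; rewrite !ffunE mul1g.
Qed.

Lemma wreath_mulr1 : right_id wreath_one wreath_mul.
Proof.
move=> [s b]; rewrite /wreath_mul /=; congr Wreath; first exact: mulg1.
by apply/ffunP => a; rewrite !ffunE mulg1 invg1 perm1.
Qed.

Lemma wreath_mulV : left_inverse wreath_one wreath_inv wreath_mul.
Proof.
move=> [s b]; rewrite /wreath_mul /=; congr Wreath; first exact: mulVg.
by apply/ffunP => a; rewrite !ffunE invgK permKV mulVg.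
Qed.

Lemma wreath_mulrV : right_inverse wreath_one wreath_inv wreath_mul.
Proof.
move=> [s b]; rewrite /wreath_mul /=; congr Wreath; first exact: mulgV.
by apply/ffunP => a; rewrite !ffunE mulgV.
Qed.

HB.instance Definition _ := isGroup.Build (wreath K A)
  wreath_mulA wreath_mul1 wreath_mulr1 wreath_mulV wreath_mulrV.

End WreathGroup.

Definition wreath_length (R : realType) (K : groupType) (ell : K -> R)
    (A : finType) (x : wreath K A) : R :=
  #|A|%:R^-1 * (\sum_(a : A | wreath_perm x a == a) ell (wreath_base x a) +
                \sum_(a : A | wreath_perm x a != a) 1).

Section WreathLength.
Context (R : realType) (K : groupType) (ell : K -> R) (A : finType).
Context (A_gt0 : (0 < #|A|)%N) (ellP : invariant_length ell).

Let f (x : wreath K A) (a : A) : R :=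
  if wreath_perm x a == a then ell (wreath_base x a) else 1.

Let lengthE x : wreath_length ell x = #|A|%:R^-1 * \sum_a f x a.
Proof.
rewrite /wreath_length [in RHS](bigID (fun a => wreath_perm x a == a)) /=.
by congr (_ * (_ + _)); apply: eq_bigr => a; rewrite /f; case: eqP.
Qed.

Let f_ge0 x a : 0 <= f x a.
Proof. by rewrite /f; case: ifP => // _; exact: il_ge0. Qed.

Let f_le1 x a : f x a <= 1.
Proof. by rewrite /f; case: ifP => // _; exact: il_le1. Qed.

Lemma wreath_length_invariant : invariant_length (wreath_length ell (A := A)).
Proof.
have cA_gt0 : 0 < #|A|%:R :> R by rewrite ltr0n.
have cV_ge0 : 0 <= #|A|%:R^-1 :> R by rewrite invr_ge0 ltW.
split=> [x|x|x|x|x y|x y]; rewrite ?lengthE.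
- by rewrite mulr_ge0 ?sumr_ge0.
- rewrite mulrC ler_pdivrMr // mul1r -[leRHS]sumr_const.
  by apply: ler_sum => a _; exact: f_le1.
- split=> [/eqP|->].
  + rewrite mulf_eq0 invr_eq0 (gt_eqF cA_gt0) /= psumr_eq0 // => /allP f0.
    have {}f0 a : f x a = 0 by apply/eqP/f0; rewrite mem_index_enum.
    case: x f0 => s b; rewrite /f /= => f0.
    have sE a : s a == a.
      by move: (f0 a); case: ifP => // _ /eqP; rewrite oner_eq0.
    congr Wreath; first by apply/permP => a; rewrite perm1; exact/eqP.
    by apply/ffunP => a; move: (f0 a); rewrite sE ffunE (il_eq0 ellP).
  + rewrite big1 ?mulr0 // => a _.
    by rewrite /f /= perm1 eqxx ffunE (il_eq0 ellP).
- congr (_ * _); apply: eq_bigr => a _.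
  rewrite /f /= !ffunE invgK (canF_eq (permKV _)) eq_sym.
  by case: eqP => // ->; rewrite (il_inv ellP).
- rewrite -mulrDr ler_wpM2l // -big_split /=; apply: ler_sum => a _.
  case: (eqVneq (wreath_perm x a) a) => xa; last first.
    have -> : f x a = 1 by rewrite /f (negPf xa).
    by apply: le_trans (f_le1 _ _) _; rewrite lerDl.
  case: (eqVneq (wreath_perm y a) a) => ya; last first.
    have -> : f y a = 1 by rewrite /f (negPf ya).
    by apply: le_trans (f_le1 _ _) _; rewrite lerDr.
  have xVa : ((wreath_perm x)^-1)%g a = a by rewrite -{1}xa permK.
  have yVa : ((wreath_perm y)^-1)%g a = a by rewrite -{1}ya permK.
  rewrite /f /= !ffunE permM xa ya eqxx yVa; exact: il_mul.
- rewrite (reindex_inj (h := ((wreath_perm x)^-1)%g)) /=; last exact: perm_inj.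
  rewrite [in RHS](reindex_inj (h := (1 : {perm A})%g)) /=; last exact: perm_inj.
  congr (_ * _); apply: eq_bigr => a _; rewrite perm1.
  rewrite /f /= !ffunE !permM permKV (inj_eq perm_inj) !invgK !permKV.
  case: eqP => // ya.
  have yVa : ((wreath_perm y)^-1)%g a = a by rewrite -{1}ya permK.
  by rewrite yVa (il_conj ellP).
Qed.

End WreathLength.

Record subgroup_type (G : groupType) (N : groupClosed G) : Type := SubgroupElt {
  subgroup_val :> G ;
  subgroup_valP : subgroup_val \in N }.

Section SubgroupGroup.
Context (G : groupType) (N : groupClosed G).

HB.instance Definition _ := [isSub for @subgroup_val G N].
HB.instance Definition _ := [Choice of subgroup_type N by <:].

Lemma subgroup_closed : group_closed N.
Proof. by split=> [|x y xN yN]; rewrite ?gpred1 ?gpredF. Qed.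

HB.instance Definition _ := SubChoice_isSubGroup.Build
  G (fun x => x \in N) (subgroup_type N) subgroup_closed.

End SubgroupGroup.

Definition normal_pred (G : groupType) (N : {pred G}) : Prop :=
  forall x y : G, x \in N -> (x ^ y)%g \in N.

Section QuotientGroup.
Context (G : groupType) (N : groupClosed G) (nN : normal_pred N).
Local Open Scope group_scope.
Local Open Scope quotient_scope.

Definition coset_rel : rel G := fun x y => x^-1 * y \in N.

Lemma coset_rel_equiv : equiv_class_of coset_rel.
Proof.
split=> [x|x y|y x z]; rewrite /coset_rel.
- by rewrite mulVg gpred1.
- by apply/idP/idP => /gpredVr; rewrite invMg invgK.
- by move=> xy yz; have := gpredM _ _ xy yz; rewrite mulgA mulgK.
Qed.

Canonical coset_equiv := EquivRelPack coset_rel_equiv.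

Definition quotient_type : Type := let _ := nN in {eq_quot coset_equiv}.

HB.instance Definition _ := Choice.copy quotient_type {eq_quot coset_equiv}.

Definition quotient_pi (x : G) : quotient_type := \pi_{eq_quot coset_equiv} x.
Definition quotient_repr (q : quotient_type) : G :=
  generic_quotient.repr (q : {eq_quot coset_equiv}).

Lemma quotient_reprK : cancel quotient_repr quotient_pi.
Proof. exact: reprK. Qed.

Lemma quotient_piP x y :
  reflect (quotient_pi x = quotient_pi y) (x^-1 * y \in N).
Proof. exact: (eqmodP coset_equiv). Qed.

Definition quotient_one : quotient_type := quotient_pi 1.
Definition quotient_mul (p q : quotient_type) : quotient_type :=
  quotient_pi (quotient_repr p * quotient_repr q).
Definition quotient_inv (p : quotient_type) : quotient_type :=
  quotient_pi (quotient_repr p)^-1.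

Lemma quotient_repr_pi x : (quotient_repr (quotient_pi x))^-1 * x \in N.
Proof. by apply/quotient_piP; rewrite quotient_reprK. Qed.

Lemma quotient_mul_pi x y :
  quotient_mul (quotient_pi x) (quotient_pi y) = quotient_pi (x * y).
Proof.
apply/quotient_piP; set x' := quotient_repr _; set y' := quotient_repr _.
have -> : (x' * y')^-1 * (x * y) = (x'^-1 * x) ^ y' * (y'^-1 * y).
  by rewrite /conjg invMg !mulgA mulgK.
by rewrite gpredM ?nN ?quotient_repr_pi.
Qed.

Lemma quotient_inv_pi x :
  quotient_inv (quotient_pi x) = quotient_pi x^-1.
Proof.
apply/quotient_piP; rewrite invgK; set x' := quotient_repr _.
have -> : x' * x^-1 = (x'^-1 * x)^-1 ^ x'^-1.
  by rewrite /conjg invMg !invgK !mulgA mulgK.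
by rewrite nN // gpredVr // quotient_repr_pi.
Qed.

Lemma quotient_ind (P : quotient_type -> Prop) :
  (forall x, P (quotient_pi x)) -> forall q, P q.
Proof. by move=> Ppi q; rewrite -[q]quotient_reprK. Qed.

Lemma quotient_mulA : associative quotient_mul.
Proof.
elim/quotient_ind=> x; elim/quotient_ind=> y; elim/quotient_ind=> z.
by rewrite !quotient_mul_pi mulgA.
Qed.

Lemma quotient_mul1 : left_id quotient_one quotient_mul.
Proof. by elim/quotient_ind=> x; rewrite quotient_mul_pi mul1g. Qed.

Lemma quotient_mulr1 : right_id quotient_one quotient_mul.
Proof. by elim/quotient_ind=> x; rewrite quotient_mul_pi mulg1. Qed.

Lemma quotient_mulV : left_inverse quotient_one quotient_inv quotient_mul.
Proof.
by elim/quotient_ind=> x; rewrite quotient_inv_pi quotient_mul_pi mulVg.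
Qed.

Lemma quotient_mulrV : right_inverse quotient_one quotient_inv quotient_mul.
Proof.
by elim/quotient_ind=> x; rewrite quotient_inv_pi quotient_mul_pi mulgV.
Qed.

HB.instance Definition _ := isGroup.Build quotient_type
  quotient_mulA quotient_mul1 quotient_mulr1 quotient_mulV quotient_mulrV.

End QuotientGroup.

(* Von Neumann's definition, for a group with the discrete topology. *)
Definition amenable (R : realType) (Q : groupType) : Prop :=
  exists mu : set Q -> R,
    [/\ forall X, 0 <= mu X,
        mu setT = 1,
        forall X Y, X `&` Y = set0 -> mu (X `|` Y) = mu X + mu Y &
        forall (q : Q) X, mu [set (q * x)%g | x in X] = mu X].

(* Main.v *)
Require Import Defs.
From mathcomp Require Import all_boot all_order all_algebra all_fingroup.
From mathcomp Require Import finmap.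
From mathcomp Require Import all_classical all_reals.
From mathcomp Require Import lra.

(** An element of the extension is recorded by how it moves cosets and by a
    cocycle with values in N.  Fix coset representatives sigma(q).  Each g
    sends sigma(q) to sigma(gq) n(g,q) with n(g,q) in N, and
    n(gh,q) = n(g,hq) n(h,q).  If phi is a quasi-homomorphism from N to K and A
    is a finite subset of Q = G/N, the map g |-> (translation by g on A, phi o
    n(g,-)) therefore fails to be a homomorphism to K wr Sym(A) in two ways only:
    phi is not exactly multiplicative, which costs eps, and translation by g is
    not exactly a permutation of A, which costs the proportion of points that
    leave A.  The second cost is small when A is a Folner set
    ([induced_map_mul]).  A nontrivial element of N fixes every coset and its
    cocycle takes nontrivial values, so its length is at least the constant for
    N; an element outside N moves every coset, so its length is almost 1
    ([induced_map_length_in], [induced_map_length_out]).  Hence the minimum of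
    the constant for N and 1/2 is a constant for G.

    Amenability is given by an invariant mean, so Folner sets have to be
    extracted from it ([amenable_folner]).  If there were none for some finite
    S and eps, then multiplying by S together with 1 would enlarge every finite
    set by a factor 1 + eps, and iterating gives a finite T with
    |TA| >= 2|A| for all finite A ([not_folner_doubling]).  This is Hall's
    condition for the bipartite graph joining each of two copies of q to the
    points of Tq, and a matching consists of two injections of Q into itself
    with disjoint images, each moving points by elements of T only
    ([doubling_paradox]).  Such an injection preserves the mean, because it is
    piecewise a translation by one of finitely many elements
    ([mean_finite_displacement]); two disjoint sets of mean 1 contradict total
    mean 1.

    Hall's theorem is needed for an infinite family of finite sets
    ([hall_matching]).  Rado's argument deals with this case directly: delete
    edges as long as Hall's condition survives; a minimal such graph exists by
    Zorn's lemma, and submodularity of the number of neighbours shows that it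
    leaves each index with a single neighbour. *)

Set Implicit Arguments.
Unset Strict Implicit.
Unset Printing Implicit Defensive.
Import Order.TTheory GRing.Theory Num.Theory.
Local Open Scope classical_set_scope.
Local Open Scope ring_scope.

(** * Hall's theorem for infinite families of finite sets *)

Section Hall.
Context (I V : choiceType).
Implicit Types (E : I -> {fset V}) (J : {fset I}) (D : set (I * V)).
Local Open Scope fset_scope.

Definition neighbors E J : {fset V} := \bigcup_(i <- J) E i.

Definition hall E := forall J, (#|` J| <= #|` neighbors E J|)%N.

(** Edges are removed by a set of pairs, so that the graphs obtained by deleting
    edges are ordered by inclusion of sets, as Zorn's lemma requires. *)
Definition prune E D i : {fset V} := [fset v in E i | (i, v) \notin D].

Lemma neighborsP E J v :
  reflect (exists2 i, i \in J & v \in E i) (v \in neighbors E J).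
Proof.
apply: (iffP (bigfcupP _ _ _ _)) => [[i /andP[iJ _] vE]|[i iJ vE]].
  by exists i.
by exists i; rewrite ?iJ.
Qed.

Lemma in_prune E D i v : (v \in prune E D i) = (v \in E i) && ((i, v) \notin D).
Proof. by rewrite !inE. Qed.

Lemma chain_union_finite (T : eqType) (F : set (set T)) (s : seq T) :
  F !=set0 -> total_on F subset ->
  exists2 X, F X & forall x, x \in s -> (\bigcup_(Y in F) Y)%classic x -> X x.
Proof.
move=> [X0 FX0] chainF; elim: s => [|x s [X FX sX]]; first by exists X0.
have [[Y FY Yx]|nx] := pselect ((\bigcup_(Y in F) Y)%classic x); last first.
  by exists X => // y; rewrite inE => /predU1P[->|/sX].
have [XY|YX] := chainF _ _ FX FY.
  by exists Y => // y; rewrite inE => /predU1P[->//|ys yF]; exact/XY/sX.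
by exists X => // y; rewrite inE => /predU1P[-> _|/sX//]; exact: YX.
Qed.

(** Zorn's lemma applies because Hall's condition for J involves only the
    finitely many edges at J: along a chain of deletions, one member already
    contains all deletions at J made by the union. *)
Lemma hall_maximal_prune E : hall E -> exists2 D, hall (prune E D) &
  forall i v, v \in prune E D i -> ~ hall (prune E (D `|` [set (i, v)])%classic).
Proof.
move=> hallE.
have [F Fhall chainF|D [hallD maxD]] := @Zorn_bigcup _ [set D | hall (prune E D)].
  rewrite /= => J.
  have [F0|/set0P F0] := eqVneq F set0.
    rewrite F0 bigcup_set0; apply: leq_trans (hallE J) _.
    apply/fsubset_leq_card/fsubsetP => v /neighborsP[i iJ vE].
    apply/neighborsP; exists i => //; rewrite in_prune vE.
    by apply/negP; rewrite inE.
  have [X FX Xmax] :=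
    chain_union_finite [seq (i, v) | i <- J, v <- E i] F0 chainF.
  apply: leq_trans (Fhall _ FX J) _.
  apply/fsubset_leq_card/fsubsetP => v /neighborsP[i iJ].
  rewrite in_prune => /andP[vE ivX]; apply/neighborsP; exists i => //.
  rewrite in_prune vE; apply: contra ivX; rewrite !inE => /Xmax; apply.
  by apply/allpairsPdep; exists i, v.
exists D => // i v; rewrite in_prune => /andP[_ /negP ivD]; apply: maxD.
split; last by move=> sub; apply: ivD; rewrite inE; apply: sub; right.
by move=> x Dx; left.
Qed.

(** If J1 and J2 witness that neither edge can be deleted, both contain i.  The
    neighbours of their union are covered by the pruned neighbourhoods M1 and M2
    (y survives in M1 and x in M2), and those of their intersection minus i lie
    in the intersection of M1 and M2.  Adding up,
    |J1| + |J2| - 1 <= |M1| + |M2|, whereas each |Mk| is at most |Jk| - 1. *)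
Lemma hall_prune_edge E i x y : hall E -> x \in E i -> y \in E i -> x != y ->
  hall (prune E [set (i, x)]%classic) \/ hall (prune E [set (i, y)]%classic).
Proof.
move=> hallE xE yE xy; apply: contrapT => /not_orP[].
move=> /existsNP[J1 /negP]; rewrite -ltnNge => J1bad.
move=> /existsNP[J2 /negP]; rewrite -ltnNge => J2bad.
have iJ J z :
    (#|` neighbors (prune E [set (i, z)]%classic) J| < #|` J|)%N -> i \in J.
  apply: contraTT => iJ; rewrite -leqNgt; apply: leq_trans (hallE J) _.
  apply/fsubset_leq_card/fsubsetP => v /neighborsP[j jJ vE].
  apply/neighborsP; exists j; rewrite // in_prune vE.
  apply/negP; rewrite inE => -[ji _].
  by rewrite -ji jJ in iJ.
have iJ1 := iJ _ _ J1bad; have iJ2 := iJ _ _ J2bad.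
set M1 := neighbors _ J1 in J1bad; set M2 := neighbors _ J2 in J2bad.
have subU : neighbors E (J1 `|` J2) `<=` M1 `|` M2.
  apply/fsubsetP => v /neighborsP[j]; rewrite !inE => jJ vE.
  have [ji|ji] := eqVneq j i; last first.
    by case/orP: jJ => jJ; apply/orP; [left|right]; apply/neighborsP; exists j => //;
      rewrite in_prune vE; apply/negP; rewrite inE => -[/eqP]; rewrite (negPf ji).
  subst j; have [vx|vx] := eqVneq v x.
    apply/orP; right; apply/neighborsP; exists i => //; rewrite in_prune vE.
    by apply/negP; rewrite inE vx => -[/eqP]; rewrite (negPf xy).
  apply/orP; left; apply/neighborsP; exists i => //; rewrite in_prune vE.
  by apply/negP; rewrite inE => -[/eqP]; rewrite (negPf vx).
have subI : neighbors E ((J1 `&` J2) `\ i) `<=` M1 `&` M2.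
  apply/fsubsetP => v /neighborsP[j]; rewrite !inE => /and3P[ji jJ1 jJ2] vE.
  by apply/andP; split; apply/neighborsP; exists j => //; rewrite in_prune vE;
    apply/negP; rewrite inE => -[/eqP]; rewrite (negPf ji).
have leU := leq_trans (hallE _) (fsubset_leq_card subU).
have leI := leq_trans (hallE _) (fsubset_leq_card subI).
have cJ := cardfsUI J1 J2; have cM := cardfsUI M1 M2.
have cI : #|` J1 `&` J2| = #|` (J1 `&` J2) `\ i|.+1.
  by rewrite (cardfsD1 i (J1 `&` J2)) inE iJ1 iJ2.
have : (#|` J1| + #|` J2| <= #|` M1| + #|` M2| + 1)%N.
  by rewrite -cJ -cM cI addn1 addnS ltnS leq_add.
apply/negP; rewrite -ltnNge addn1.
by have := leq_add J1bad J2bad; rewrite addSn addnS.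
Qed.

Lemma hall_matching E : hall E ->
  exists2 f : I -> V, injective f & forall i, f i \in E i.
Proof.
move=> /hall_maximal_prune[D hallD maxD]; set E' := prune E D in hallD maxD.
have E'1 i : exists v, E' i = [fset v].
  have [v vE] : exists v, v \in E' i.
    have /fset0Pn[v] : neighbors E' [fset i] != fset0.
      by rewrite -cardfs_gt0; apply: leq_trans (hallD _); rewrite cardfs1.
    by move=> /neighborsP[j]; rewrite inE => /eqP -> ?; exists v.
  exists v; apply/fsetP => w; rewrite inE; apply/idP/eqP => [wE|->//].
  apply: contrapT => /eqP wv.
  have pruneE z :
      prune E' [set (i, z)]%classic = prune E (D `|` [set (i, z)])%classic.
    by apply/funext => j; apply/fsetP => u; rewrite !in_prune in_setU negb_or andbA.
  have := hall_prune_edge hallD wE vE wv; rewrite !pruneE.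
  by case; exact: maxD.
have [f fE'] := choice E'1.
exists f => [i j fij|i]; last first.
  have : f i \in E' i by rewrite fE' inE.
  by rewrite in_prune => /andP[].
apply: contrapT => /eqP ij; have := hallD [fset i; j].
rewrite cardfs2 ij /= leqNgt ltnS => /negP; apply.
rewrite -(cardfs1 (f i)); apply/fsubset_leq_card/fsubsetP => v /neighborsP[k].
by rewrite fE' !inE => /pred2P[->//|->]; rewrite fij.
Qed.
End Hall.

(** * Folner sets from an invariant mean *)

Section Folner.
Context (R : realType) (Q : groupType).
Implicit Types (T A : {fset Q}).
Local Open Scope fset_scope.
Local Open Scope ring_scope.

Definition translates T A : {fset Q} := [fset (t * a)%g | t in T, a in A].

Lemma translatesP T A x :
  reflect (exists t a, [/\ t \in T, a \in A & x = (t * a)%g]) (x \in translates T A).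
Proof.
apply: (iffP (@imfset2P _ _ _ _ _ _ _ _)) => [[t tT [a aA ->]]|[t [a [tT aA ->]]]].
  by exists t, a.
by exists t => //; exists a.
Qed.

Lemma translatesA T1 T2 A :
  translates (translates T1 T2) A = translates T1 (translates T2 A).
Proof.
apply/fsetP => x; apply/translatesP/translatesP.
  move=> [_ [a [/translatesP[t1 [t2 [? ? ->]]] ? ->]]].
  by exists t1, (t2 * a)%g; split; rewrite ?mulgA //; apply/translatesP; exists t2, a.
move=> [t1 [_ [? /translatesP[t2 [a [? ? ->]]] ->]]].
by exists (t1 * t2)%g, a; split; rewrite ?mulgA //; apply/translatesP; exists t1, t2.
Qed.

Definition boundary (s : Q) A : {fset Q} := [fset a in A | (s * a)%g \notin A].

(** The left translate by s of the boundary is disjoint from A, and both lie in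
    the product set. *)
Lemma boundary_expansion (S : seq Q) s A : s \in S ->
  (#|` A| + #|` boundary s A| <= #|` translates (1%g |` [fset x in S]) A|)%N.
Proof.
move=> sS; set T := _ |` _.
have -> : #|` boundary s A| = #|` [fset (s * a)%g | a in boundary s A]|.
  by rewrite [RHS]card_imfset //; exact: mulgI.
have /eqP I0 : A `&` [fset (s * a)%g | a in boundary s A] == fset0.
  apply/eqP/fsetP => x; rewrite !inE; apply/negP => /andP[xA /imfsetP[a /=]].
  by rewrite !inE => /andP[_ /negP saA] xE; rewrite -xE in saA.
rewrite -cardfsUI I0 cardfs0 addn0; apply/fsubset_leq_card/fsubsetP => x.
rewrite inE => /orP[xA|/imfsetP[a /=]].
  by apply/translatesP; exists 1%g, x; rewrite mul1g !inE eqxx.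
rewrite !inE => /andP[aA _] ->; apply/translatesP; exists s, a; split=> //.
by rewrite !inE sS orbT.
Qed.

Definition folner : Prop := forall (S : seq Q) (eps : R), 0 < eps ->
  exists2 A : {fset Q}, A != fset0 &
    forall s, s \in S -> (#|` boundary s A|)%:R <= eps * (#|` A|)%:R.

(** Products of k copies of the expanding set enlarge by at least 1 + k eps, by
    Bernoulli's inequality; k >= 1/eps suffices. *)
Lemma not_folner_doubling : ~ folner ->
  exists T, forall A, (2 * #|` A| <= #|` translates T A|)%N.
Proof.
move=> /existsNP[S /existsNP[eps]] /not_implyP[eps0 noA].
pose T1 := 1%g |` [fset x in S].
have T1P A : (1 + eps) * (#|` A|)%:R <= (#|` translates T1 A|)%:R.
  have [->|A0] := eqVneq A fset0; first by rewrite cardfs0 mulr0 ler0n.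
  have /existsNP[s /not_implyP[sS /negP]] : ~ forall s, s \in S ->
      (#|` boundary s A|)%:R <= eps * (#|` A|)%:R :> R.
    by move=> bdA; apply: noA; exists A.
  rewrite -ltNge => /ltW bdA; rewrite mulrDl mul1r.
  apply: le_trans (lerD (lexx _) bdA) _.
  by rewrite -natrD ler_nat boundary_expansion.
have growth k : exists T, forall A,
    (1 + k%:R * eps) * (#|` A|)%:R <= (#|` translates T A|)%:R.
  elim: k => [|k [T TP]].
    exists [fset 1%g] => A; rewrite mul0r addr0 mul1r ler_nat.
    apply/fsubset_leq_card/fsubsetP => x xA; apply/translatesP.
    by exists 1%g, x; rewrite mul1g inE.
  exists (translates T1 T) => A; rewrite translatesA; apply: le_trans (T1P _).
  (* the induction step of Bernoulli's inequality:
     (1 + eps)(1 + k eps) >= 1 + (k + 1) eps *)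
  apply: (@le_trans _ _ ((1 + eps) * ((1 + k%:R * eps) * (#|` A|)%:R))); last first.
    by rewrite ler_wpM2l ?TP // addr_ge0 // ltW.
  rewrite mulrA ler_wpM2r //.
  have : 0 <= k%:R * eps ^+ 2 :> R by rewrite mulr_ge0 // sqr_ge0.
  rewrite -natr1; lra.
pose k := Num.bound eps^-1; have [T TP] := growth k.
exists T => A; rewrite -(ler_nat R) natrM; apply: le_trans (TP A).
rewrite ler_wpM2r //.
have : 1 <= k%:R * eps.
  by rewrite -ler_pdivrMr // div1r ltW // archi_boundP // invr_ge0 ltW.
lra.
Qed.

(** The boolean coordinate indexes the two copies of Q, so the two injections
    have disjoint images as soon as f is injective. *)
Lemma doubling_paradox T : (forall A, (2 * #|` A| <= #|` translates T A|)%N) ->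
  exists2 f : Q * bool -> Q, injective f &
    forall x, (f x * x.1^-1)%g \in T.
Proof.
move=> T2; pose E (x : Q * bool) := translates T [fset x.1].
suff /hall_matching[f finj fE] : hall E.
  exists f => // x; have /translatesP[t [a [tT]]] := fE x.
  by rewrite inE => /eqP -> ->; rewrite mulgK.
move=> J; pose A := [fset x.1 | x in J].
apply: (@leq_trans (2 * #|` A|)); last first.
  apply: leq_trans (T2 A) _; apply/fsubset_leq_card/fsubsetP => v.
  move=> /translatesP[t [_ [tT /imfsetP[x /= xJ ->] ->]]].
  apply/neighborsP; exists x => //; apply/translatesP.
  by exists t, x.1; rewrite inE.
pose J' b := [fset x in J | x.2 == b].
have J'A b : (#|` J' b| <= #|` A|)%N.
  have -> : #|` J' b| = #|` [fset x.1 | x in J' b]|.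
    rewrite [RHS]card_in_imfset //= => -[a1 b1] [a2 b2].
    by rewrite !inE /= => /andP[_ /eqP->] /andP[_ /eqP->] ->.
  apply/fsubset_leq_card/fsubsetP => _ /imfsetP[x /= + ->].
  by rewrite !inE => /andP[xJ _]; apply/imfsetP; exists x.
have <- : J' true `|` J' false = J.
  by apply/fsetP => x; rewrite !inE -andb_orr; case: x.2; rewrite andbT.
by rewrite mul2n -addnn; apply: leq_trans (leq_card_fsetU _ _) _; exact: leq_add.
Qed.

Section Mean.
Variable mu : set Q -> R.
Hypothesis muD : forall X Y : set Q,
  (X `&` Y = set0 -> mu (X `|` Y) = mu X + mu Y)%classic.
Hypothesis muM : forall q (X : set Q), mu [set (q * x)%g | x in X]%classic = mu X.

Lemma mean0 : mu set0 = 0.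
Proof.
have := muD (set0I set0); rewrite setU0 => /eqP.
by rewrite -[X in X == _]addr0 (inj_eq (addrI _)) eq_sym => /eqP.
Qed.

(** On the points displaced by a given element t, the map f is the translation by
    t, so the mean is preserved piece by piece. *)
Lemma mean_finite_displacement (f : Q -> Q) (s : seq Q) (X : set Q) :
  injective f -> (forall x, X x -> (f x * x^-1)%g \in s) ->
  mu [set f x | x in X]%classic = mu X.
Proof.
move=> finj; elim: s X => [|t s IH] X Xs.
  have -> : X = set0 by apply/seteqP; split => // x /Xs.
  by rewrite image_set0.
pose X1 := (X `&` [set x | f x = t * x]%g)%classic.
pose X2 := (X `&` [set x | f x <> t * x]%g)%classic.
have XE : X = (X1 `|` X2)%classic.
  apply/seteqP; split => x; last by move=> [[]|[]].
  by move=> Xx; have [?|?] := pselect (f x = t * x)%g; [left|right].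
have X12 : (X1 `&` X2 = set0)%classic.
  by apply/seteqP; split => // x [[_ ?] [_]].
rewrite XE image_setU !muD //; last first.
  apply/seteqP; split => // _ [[x [_ xt] <-] [y [_ yt] /finj yx]].
  by apply: yt; rewrite yx.
congr (_ + _).
  rewrite -[RHS](muM t); congr mu; apply/seteqP; split => _ [x [Xx xt] <-].
    by exists x.
  by exists x.
apply: IH => x [Xx xt]; have := Xs x Xx; rewrite inE => /predU1P[fx|//].
by case: xt; rewrite /= -fx mulgKV.
Qed.
End Mean.

Lemma amenable_folner : amenable R Q -> folner.
Proof.
move=> [mu [mu_ge0 mu1 muD muM]]; apply: contrapT => /not_folner_doubling[T].
move=> /doubling_paradox[f finj fT].
pose X b := [set f (x, b) | x in setT]%classic.
have muX b : mu (X b) = 1.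
  rewrite -mu1.
  apply: (mean_finite_displacement muD muM (s := T)) => [x y /finj[]//|x _].
  exact: fT (x, b).
have X12 : (X true `&` X false = set0)%classic.
  by apply/seteqP; split => // _ [[x _ <-] [y _ /finj]].
have := muD _ _ (setICr (X true `|` X false)%classic).
rewrite setUCr mu1 muD // !muX.
have := mu_ge0 (~` (X true `|` X false))%classic; lra.
Qed.
End Folner.

(** * Approximate translations of a finite set *)

(** The permutation is built one point at a time, correcting the value at the new
    point by a transposition; injectivity keeps the earlier values untouched. *)
Lemma perm_extension (T : finType) (f : T -> T) (P : pred T) :
  {in P &, injective f} -> exists t : {perm T}, {in P, t =1 f}.
Proof.
move=> finjP; suff [t tf] : exists t : {perm T}, {in enum P, t =1 f}.
  by exists t => x Px; apply: tf; rewrite mem_enum.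
have : {in enum P &, injective f} by move=> x y; rewrite !mem_enum; exact: finjP.
elim: (enum P) => [_|x s IH finj]; first by exists 1%g.
have [|t tf] := IH; first by move=> y z ys zs; apply: finj; rewrite inE ?ys ?zs orbT.
exists (t * tperm (t x) (f x))%g => y; rewrite permM inE => yxs.
have [->|yx] := eqVneq y x; first by rewrite tpermL.
move: yxs; rewrite (negPf yx) /= => ys.
rewrite tpermD; [exact: tf | by rewrite (inj_eq perm_inj) eq_sym |].
by rewrite tf //; apply: contraNneq yx => /finj <- //; rewrite inE ?eqxx ?ys ?orbT.
Qed.

Section Translation.
Context (Q : groupType) (A : {fset Q}).

(** The translation is an injective partial map of A, so it extends to a
    permutation; elsewhere the extension is arbitrary. *)
Lemma translation_perm (q : Q) :
  exists t : {perm A}, forall a : A,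
    (q * val a)%g \in A -> val (t a) = (q * val a)%g.
Proof.
have [|t tE] := @perm_extension A (fun a => insubd a (q * val a)%g)
    [pred a | (q * val a)%g \in A].
  move=> a b /[!inE] qa qb /(congr1 val).
  by rewrite !val_insubd qa qb => /mulgI/val_inj.
by exists t => a qa; rewrite tE ?inE // insubdK.
Qed.

Definition leaving (q : Q) : {set A} := [set a | (q * val a)%g \notin A]%SET.

Lemma card_leaving q : (#|leaving q| <= #|` boundary q A|)%N.
Proof.
rewrite cardE -(size_map val); apply: uniq_leq_size.
  by rewrite map_inj_uniq ?enum_uniq //; exact: val_inj.
by move=> _ /mapP[a + ->]; rewrite mem_enum !inE => ->; rewrite (valP a).
Qed.
End Translation.

(** * Lengths in the wreath product *)

Section WreathBounds.
Context (R : realType) (K : groupType) (ell : K -> R) (A : finType).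
Context (A_gt0 : (0 < #|A|)%N) (ellP : invariant_length ell).
Implicit Types (x y : wreath K A) (B : {set A}).

Let f (x : wreath K A) (a : A) : R :=
  if wreath_perm x a == a then ell (wreath_base x a) else 1.

Let lengthE x : wreath_length ell x = #|A|%:R^-1 * \sum_a f x a.
Proof.
rewrite /wreath_length [in RHS](bigID (fun a => wreath_perm x a == a)) /=.
by congr (_ * (_ + _)); apply: eq_bigr => a; rewrite /f; case: eqP.
Qed.

Let card_sum B : #|B|%:R = \sum_a (a \in B)%:R :> R.
Proof. by rewrite -natr_sum -sum1_card [in LHS]big_mkcond. Qed.

(** Length of x y^-1 is an average over A.  Reindexed by the target point, a term
    outside B is the length of a quotient of base components, and a term in B
    is at most 1. *)
Lemma wreath_length_div_le (e : R) B x y : 0 <= e ->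
    (forall a, a \notin B -> (wreath_perm x)^-1%g a = (wreath_perm y)^-1%g a /\
      ell (wreath_base x a * (wreath_base y a)^-1)%g <= e) ->
  wreath_length ell (x * y^-1)%g <= e + #|B|%:R / #|A|%:R.
Proof.
move=> e_ge0 xy; have cA_gt0 : 0 < #|A|%:R :> R by rewrite ltr0n.
rewrite lengthE mulrC ler_pdivrMr // mulrDl divfK ?gt_eqF //.
rewrite mulr_natr -sumr_const card_sum -big_split /=.
rewrite (reindex_inj (h := (wreath_perm y)^-1%g)) /=; last exact: perm_inj.
apply: ler_sum => a _; case: (boolP (a \in B)) => aB.
  rewrite /f; case: ifP => _; last by rewrite lerDr.
  by apply: le_trans (il_le1 ellP _) _; rewrite lerDr.
have [xya le_e] := xy a aB; rewrite addr0 /f /= permM -{1}xya permKV eqxx.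
by rewrite !ffunE !invgK !permKV.
Qed.

Lemma wreath_length_ge (c : R) B x : c <= 1 ->
    (forall a, a \notin B -> wreath_perm x a = a -> c <= ell (wreath_base x a)) ->
  c - #|B|%:R / #|A|%:R <= wreath_length ell x.
Proof.
move=> c_le1 xB; have cA_gt0 : 0 < #|A|%:R :> R by rewrite ltr0n.
rewrite lerBlDr -(ler_pM2r cA_gt0) mulrDl divfK ?gt_eqF // lengthE.
rewrite mulrAC mulVf ?gt_eqF // mul1r card_sum -big_split /=.
rewrite mulr_natr -sumr_const; apply: ler_sum => a _; rewrite /f.
case: (boolP (a \in B)) => aB.
  apply: le_trans c_le1 _; rewrite lerDr.
  by case: ifP => _; rewrite ?(il_ge0 ellP).
by rewrite addr0; case: ifP => // /eqP; exact: xB.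
Qed.
End WreathBounds.

(** * The cocycle of an extension *)

Section Cocycle.
Context (G : groupType) (N : groupClosed G) (nN : normal_pred N).
Local Notation Q := (quotient_type nN).
Local Notation pi := (quotient_pi nN).
Local Notation sg := (@quotient_repr G N nN).
Local Open Scope group_scope.

Lemma pi1 : pi 1 = 1.
Proof. by []. Qed.

Lemma piM g h : pi (g * h) = pi g * pi h.
Proof. exact/esym/quotient_mul_pi. Qed.

Lemma cocycle_subproof g (q : Q) : (sg (pi g * q))^-1 * (g * sg q) \in N.
Proof. by apply/quotient_piP; rewrite quotient_reprK piM quotient_reprK. Qed.

Definition cocycle g (q : Q) : subgroup_type N :=
  SubgroupElt (cocycle_subproof g q).

Lemma cocycle1 q : cocycle 1 q = 1.
Proof. by apply: val_inj; rewrite /= pi1 !mul1g mulVg. Qed.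

Lemma cocycleM g h q : cocycle (g * h) q = cocycle g (pi h * q) * cocycle h q.
Proof.
by apply: val_inj; rewrite /= piM !mulgA mulgK.
Qed.

Lemma pi_eq1 g : (pi g = 1) <-> (g \in N).
Proof.
rewrite -pi1; split=> [/esym/quotient_piP|gN]; first by rewrite invg1 mul1g.
by apply/esym/quotient_piP; rewrite invg1 mul1g.
Qed.

Lemma cocycle_neq1 g q : g \in N -> g <> 1 -> cocycle g q <> 1.
Proof.
move=> /pi_eq1 pg g1 /(congr1 val); rewrite /= pg mul1g => /eqP.
rewrite -(inj_eq (mulgI (sg q))) mulKVg mulg1 => /eqP gE; apply: g1.
by apply: (mulIg (sg q)); rewrite mul1g.
Qed.
End Cocycle.

(** * The quasi-homomorphism induced from a normal subgroup *)

Section Induced.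
Context (R : realType) (G : groupType) (N : groupClosed G) (nN : normal_pred N).
Local Notation Q := (quotient_type nN).
Local Notation pi := (quotient_pi nN).
Context (K : groupType) (ell : K -> R) (ellP : invariant_length ell).
Context (A : {fset Q}) (A0 : A != fset0) (phi : subgroup_type N -> K).
Context (t : Q -> {perm A}).
Hypothesis tE : forall q (a : A), (q * val a)%g \in A -> val (t q a) = (q * val a)%g.

(** Permutations compose from left to right, whereas g |-> (q |-> gq) is a left
    action; hence the inverse of t.  The base component is indexed by the source
    point of the translation, which is the target of its inverse, as the product
    of the wreath product requires. *)
Definition induced_map (g : G) : wreath K A :=
  Wreath (t (pi g))^-1 [ffun a => phi (cocycle g (val a))].

Let A_gt0 : (0 < #|{: A}|)%N.
Proof. by rewrite -cardfE cardfs_gt0. Qed.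

Lemma induced_map1 : phi 1%g = 1%g -> induced_map 1%g = 1%g.
Proof.
move=> phi1; rewrite /induced_map; congr Wreath.
  rewrite -[RHS]invg1; congr (_^-1)%g; apply/permP => a; apply: val_inj.
  by rewrite perm1 pi1 tE mul1g ?(valP a).
by apply/ffunP => a; rewrite !ffunE cocycle1.
Qed.

(** Both sides of the product rule agree at a up to eps when a and ha stay in A
    under translation by h and by g: there the permutations are true
    translations and the cocycle identity applies.  The exceptions are the a
    that leave under h and those whose image under t leaves under g, at most
    twice the proportion d. *)
Lemma induced_map_mul (eps d : R) g h : 0 <= eps ->
    (forall q, q \in A -> (pi h * q)%g \in A ->
      ell (phi (cocycle g (pi h * q) * cocycle h q) * (phi (cocycle h q))^-1 *
        (phi (cocycle g (pi h * q)))^-1)%g <= eps) ->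
    #|leaving A (pi g)|%:R <= d * #|{: A}|%:R ->
    #|leaving A (pi h)|%:R <= d * #|{: A}|%:R ->
  wreath_length ell
    (induced_map (g * h) * (induced_map h)^-1 * (induced_map g)^-1)%g
  <= eps + 2 * d.
Proof.
move=> eps0 phiM dg dh; rewrite -mulgA -invMg.
pose B : {set A} := (leaving A (pi h) :|: t (pi h) @^-1: leaving A (pi g))%SET.
have cA_gt0 : 0 < #|{: A}|%:R :> R by rewrite ltr0n.
apply: (@le_trans _ _ (eps + #|B|%:R / #|{: A}|%:R)); last first.
  rewrite lerD2l ler_pdivrMr //.
  have : #|B|%:R <= #|leaving A (pi h)|%:R + #|leaving A (pi g)|%:R :> R.
    rewrite -natrD ler_nat.
    rewrite -(card_preimset (leaving A (pi g)) (@perm_inj _ (t (pi h)))).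
    exact: leq_card_setU.
  lra.
apply: wreath_length_div_le => // a.
rewrite !inE negb_or !negbK => /andP[ha]; rewrite tE // => gha; split.
  apply: val_inj; rewrite /= invMg !invgK permM [RHS]tE ?[in LHS]tE ?tE // piM.
    by rewrite mulgA.
  by rewrite -mulgA.
rewrite /= !ffunE invgK tE // cocycleM invMg mulgA.
by apply: phiM => //; exact: valP.
Qed.

(** Every point contributes at least c: 1 if it is displaced, and the length of
    a value of phi on the cocycle otherwise. *)
Lemma induced_map_length_in (c : R) g : c <= 1 -> g \in N ->
    (forall q, q \in A -> c <= ell (phi (cocycle g q))) ->
  c <= wreath_length ell (induced_map g).
Proof.
move=> c1 gN gc; rewrite -[c]subr0 -(mul0r #|{: A}|%:R^-1) -[0]/(0%:R) -(cards0 A).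
by apply: wreath_length_ge => // a _ _; rewrite ffunE; exact: gc (valP a).
Qed.

(** A fixed point q of a true translation by g would give gq = q, that is, g in
    N; so only leaving points can be fixed. *)
Lemma induced_map_length_out g : g \notin N ->
  1 - #|leaving A (pi g)|%:R / #|{: A}|%:R <= wreath_length ell (induced_map g).
Proof.
move=> gN; apply: wreath_length_ge => // a; rewrite inE negbK => ga /= taV.
have /(congr1 val) : t (pi g) a = a by rewrite -{1}taV permKV.
rewrite tE // -[RHS]mul1g => /mulIg/pi_eq1; by rewrite (negPf gN).
Qed.
End Induced.

(** * Extensions by amenable groups *)

Theorem theorem5p1 (R : realType) (C : length_class R)
    (C_length : is_length_class C)
    (C_wreath : forall (K : groupType) (ell : K -> R) (A : finType),
       C K ell -> (0 < #|A|)%N -> C (wreath K A) (wreath_length ell (A := A)))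
    (G : groupType) (N : groupClosed G) (nN : normal_pred N)
    (N_approx : discrete_approximation_property C (subgroup_type N))
    (GN_amenable : amenable R (quotient_type nN)) :
  discrete_approximation_property C G.
Proof.
have [delta [[_ delta_gt0] N_with [c deltaE]]] := N_approx.
(* If N is trivial, c is arbitrary and may fail to be positive. *)
pose c' : R := if 0 < c then Num.min c 2^-1 else 2^-1.
have c'_gt0 : 0 < c'.
  by rewrite /c'; case: ifP => c0; rewrite ?lt_min ?c0 ?invr_gt0 ltr0n.
have c'_le : c' <= 2^-1 by rewrite /c'; case: ifP => // _; rewrite ge_min lexx orbT.
have c'_le_delta n : n <> 1%g -> c' <= delta n.
  move=> n1; have := delta_gt0 _ n1; rewrite deltaE // /c' => ->.
  by rewrite ge_min lexx.
exists (fun g => if g == 1%g then 0 else c'); split; last first.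
- by exists c' => g /eqP/negPf ->.
- move=> eps _ eps_gt0 /finite_seqP[F ->].
  (* eps / 4: the two sources of error in a product cost 2 d out of eps / 2;
     1/2: elements outside N keep length 1 - d >= 1/2. *)
  pose d : R := Num.min (eps / 4) 2^-1.
  have d_gt0 : 0 < d by rewrite lt_min divr_gt0 //= invr_gt0.
  have [A A0 bdA] :=
    amenable_folner GN_amenable [seq quotient_pi nN g | g <- F] d_gt0.
  have A_gt0 : (0 < #|{: A}|)%N by rewrite -cardfE cardfs_gt0.
  have leave g : g \in F -> #|leaving A (quotient_pi nN g)|%:R <= d * #|{: A}|%:R.
    move=> gF; rewrite -cardfE; apply: le_trans (bdA _ (map_f _ gF)).
    by rewrite ler_nat card_leaving.
  have [t tE] := choice (translation_perm A).
  pose FN := [seq cocycle g q | g <- F, q <- A].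
  have [//||K [ell [phi [CK [phi1 phiM phiW]]]]] := N_with (eps / 2) [set` FN].
  - by rewrite divr_gt0.
  - exact: finite_seq.
  have ellP := C_length _ _ CK.
  have cFN g q : g \in F -> q \in A -> [set` FN] (cocycle g q).
    by move=> gF qA; apply/allpairsP; exists (g, q).
  exists (wreath K A), (wreath_length ell (A := A)), (induced_map phi t).
  split; first exact: C_wreath.
  split=> [|g h gF hF|g gF g1]; first exact: induced_map1.
  + apply: (@le_trans _ _ (eps / 2 + 2 * d)).
      apply: induced_map_mul => // [|q qA hqA||];
        [|by apply: phiM; apply: cFN|exact: leave..].
      by rewrite divr_ge0 ?ltW.
    have : d <= eps / 4 by rewrite ge_min lexx.
    lra.
  + rewrite (negPf (introN eqP g1)).
    case: (boolP (g \in N)) => gN.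
      apply: induced_map_length_in => // [|q qA]; first lra.
      have n1 := cocycle_neq1 (q := q) gN g1; apply: le_trans (c'_le_delta _ n1) _.
      by apply: phiW => //; exact: cFN.
    apply: le_trans (induced_map_length_out ellP A0 phi tE gN).
    have : #|leaving A (quotient_pi nN g)|%:R / #|{: A}|%:R <= d.
      by rewrite ler_pdivrMr ?ltr0n // leave.
    have : d <= 2^-1 by rewrite ge_min lexx orbT.
    lra.
- by split=> [|g /eqP/negPf ->//]; rewrite eqxx.
Qed.
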